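(* Let $h\in\mathbb{R}$, $\varrho\in(-1,1)$, $r=\frac{\varrho}{\sqrt{1-\varrho^2}}$ and $q=\frac12(1+r^2)h^2=\frac{h^2}{2(1-\varrho^2)}$. For $k\ge 0$ put $c_k=\frac{(2k)!!}{(2k+1)!!}\,P(k+1,q)$. Then $$\Phi_\varrho^2(h,0)=\frac12\Phi(h)+\frac{\arctan r}{2\pi}-\frac{r}{2\pi(1+r^2)}\sum_{k=0}^\infty c_k\left(\frac{r^2}{1+r^2}\right)^k=\frac12\Phi(h)+\frac{\arcsin\varrho}{2\pi}-\frac{\sqrt{1-\varrho^2}}{2\pi}\sum_{k=0}^\infty c_k\,\varrho^{2k+1}.$$ The series $S=\sum_{k=0}^\infty c_k\left(\frac{r^2}{1+r^2}\right)^k$ converges for every $r,h\in\mathbb{R}$. If it is truncated after the $n$-th term, where $n\ge-1$ is an integer, then $$\Phi_\varrho^2(h,0)=\frac12\Phi(h)+\frac{\arctan r}{2\pi}-\frac{r\,S_n}{2\pi(1+r^2)}-\mathrm{sgn}(r)\,R_n,$$ where $S_n=\sum_{k=0}^n c_k\left(\frac{r^2}{1+r^2}\right)^k$ and $R_n=\frac{|r|}{2\pi(1+r^2)}\sum_{k=n+1}^\infty c_k\left(\frac{r^2}{1+r^2}\right)^k$ is bounded by $$0\le R_n\le\frac{B_n}{1+e^{-q}r^2}\le B_n,\qquad\text{where}\qquad B_n=\frac{(2n+2)!!}{(2n+3)!!}\,\frac{|r|}{2\pi}\,(1-e^{-q})^{n+2}\left(\frac{r^2}{1+r^2}\right)^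{n+1}.$$
   Context: $\Phi(x)=\frac{1}{\sqrt{2\pi}}\int_{-\infty}^x e^{-t^2/2}\,\mathrm{d}t$ is the standard normal distribution function. For $\varrho\in(-1,1)$, the bivariate standard normal distribution function (the superscript $2$ is notation, not a power) is $$\Phi_\varrho^2(x,y)=\frac{1}{2\pi\sqrt{1-\varrho^2}}\int_{-\infty}^x\int_{-\infty}^y e^{-\frac{s^2-2\varrho st+t^2}{2(1-\varrho^2)}}\,\mathrm{d}s\,\mathrm{d}t.$$ For $a>0$, $x\ge0$, $P(a,x)=\frac{1}{\Gamma(a)}\int_0^x t^{a-1}e^{-t}\,\mathrm{d}t$ is the lower regularized gamma function. $\mathrm{sgn}(x)=1$ if $x\ge0$ and $\mathrm{sgn}(x)=-1$ if $x<0$. Double factorials: $(2k)!!=2^kk!$ (so $0!!=1$), $(2k+1)!!=1\cdot3\cdots(2k+1)$. Empty sums are $0$ (so $S_{-1}=0$) and $0^0=1$ in power series. *)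

(* Defs.v *)
From HB Require Import structures.
From mathcomp Require Import all_boot all_order all_algebra.
From mathcomp Require Import all_classical all_reals all_analysis.

Set Implicit Arguments.
Unset Strict Implicit.
Unset Printing Implicit Defensive.

Import Order.TTheory GRing.Theory Num.Theory.
Import numFieldNormedType.Exports.

Local Open Scope classical_set_scope.
Local Open Scope ring_scope.

Fixpoint double_fact (n : nat) : nat :=
  if n is m.+2 then (n * double_fact m)%N else 1%N.

Lemma double_fact_even (k : nat) : double_fact (2 * k) = (2 ^ k * k`!)%N.
Proof.
elim: k => [|k IHk] //.
by rewrite mulnS /= IHk factS expnS mulnACA mulnS.
Qed.

Lemma double_fact_odd (k : nat) :
  double_fact (2 * k + 1) = (\prod_(i < k.+1) (2 * i + 1))%N.
Proof.
elim: k => [|k IHk]; first by rewrite big_ord_recr big_ord0.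
have -> : (2 * k.+1 + 1 = (2 * k + 1).+2)%N by rewrite mulnS.
by rewrite big_ord_recr -IHk /= [LHS]mulnC (mulnS 2 k) -addnA add2n.
Qed.

Section Special.
Context {R : realType}.
Implicit Types a x y rho : R.

(* All integrals are real-valued Lebesgue integrals. *)

Definition Phi x : R :=
  1 / Num.sqrt (2 * pi) *
  \int[lebesgue_measure]_(t in `]-oo, x]) expR (- (t ^+ 2) / 2).

(* Iterated integral: s is the inner variable, with bound y. *)
Definition Phi2 rho x y : R :=
  1 / (2 * pi * Num.sqrt (1 - rho ^+ 2)) *
  \int[lebesgue_measure]_(t in `]-oo, x])
    \int[lebesgue_measure]_(s in `]-oo, y])
      expR (- ((s ^+ 2 - 2 * rho * s * t + t ^+ 2) / (2 * (1 - rho ^+ 2)))).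

Definition Gamma a : R :=
  \int[lebesgue_measure]_(t in `]0, +oo[) (t `^ (a - 1) * expR (- t)).

(* Lower regularized gamma function, meaningful for a > 0 and x >= 0. *)
Definition gammaP a x : R :=
  1 / Gamma a *
  \int[lebesgue_measure]_(t in `]0, x]) (t `^ (a - 1) * expR (- t)).

(* Unlike Num.sg, this takes the value 1 at 0. *)
Definition sgn x : R := if 0 <= x then 1 else -1.

Definition coef (q : R) (k : nat) : R :=
  (double_fact (2 * k))%:R / (double_fact (2 * k + 1))%:R * gammaP k.+1%:R q.

End Special.

(* Main.v *)
(* Substituting s = rho t + sqrt(1 - rho^2) v in the inner integral gives
   Phi2 rho h 0 = K(r) / (2 pi) with K(r) = int_{t <= h} e^{-t^2/2} G(-r t) dt and
   G(x) = int_{v <= x} e^{-v^2/2} dv. Differentiating under the integral sign,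
   K'(r) = e^{-q(r)} / (1 + r^2) with q(r) = (1 + r^2) h^2 / 2, and
   K(0) = pi Phi(h), so it remains to expand atan r - (K(r) - K(0)), whose
   derivative is f_0(r) = (1 - e^{-q(r)}) / (1 + r^2).
   With w_k = (2k)!!/(2k+1)!!, the k-th term of the series,
   w_k P(k+1, q(r)) r^{2k+1} / (1 + r^2)^{k+1}, has derivative f_k - f_{k+1} where
   f_k(r) = w_k (2k+1) P(k+1, q(r)) r^{2k} / (1 + r^2)^{k+1}: the sum telescopes, and
   by the mean value theorem the n-th remainder is at most |r| sup |f_n|, which tends
   to 0 because P(n+1, q) <= q^{n+1} / (n+1)!.
   The bound on R_n comes from P(k+1, q) <= (1 - e^{-q})^{k+1} and a geometric sum. *)
Require Import Defs.
From HB Require Import structures.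
From mathcomp Require Import all_boot all_order all_algebra.
From mathcomp Require Import all_classical all_reals all_analysis.
From mathcomp Require Import measurable_realfun.
From mathcomp Require Import zify ring lra.

Set Implicit Arguments.
Unset Strict Implicit.
Unset Printing Implicit Defensive.

Import Order.TTheory GRing.Theory Num.Theory.
Import numFieldNormedType.Exports.
Local Open Scope classical_set_scope.
Local Open Scope ring_scope.

(** * Regularized incomplete gamma function at integers *)

Lemma is_derive_continuous (R : realType) (f df : R -> R) :
  (forall x : R, is_derive x 1 f (df x)) -> continuous f.
Proof.
move=> fdf x; apply/differentiable_continuous/derivable1_diffP.
exact: (@ex_derive _ _ _ _ _ _ _ (fdf x)).
Qed.

(** Both signs of [y] are treated at once: [|c| <= |y|] serves the remainder estimate of the series,
    the sign clause serves inequalities on [q >= 0]. *)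
Lemma mean_value_from0 (R : realType) (f df : R -> R) (y : R) :
  (forall x : R, is_derive x 1 f (df x)) ->
  exists c, [/\ `|c| <= `|y|, 0 <= y -> 0 <= c & f y - f 0 = df c * y].
Proof.
move=> fdf; have cf := is_derive_continuous fdf.
have [y0|y0] := leP 0 y.
  have [c] := MVT_segment y0 (fun x _ => fdf x) (continuous_subspaceT cf).
  rewrite in_itv/= subr0 => /andP[c0 cy] ->; exists c.
  by rewrite !ger0_norm.
have [c] := MVT_segment (ltW y0) (fun x _ => fdf x) (continuous_subspaceT cf).
rewrite in_itv/= sub0r => /andP[yc c0] E; exists c; split.
- by rewrite !ler0_norm ?lerN2// ltW.
- by [].
- by rewrite -opprB E mulrN opprK.
Qed.

(* The probability that a Poisson variable of mean q exceeds k, i.e. P(k+1, q). *)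
Definition poisson_tail (R : realType) (k : nat) (q : R) : R :=
  1 - expR (- q) * \sum_(j < k.+1) q ^+ j / j`!%:R.

Lemma poisson_tail0 (R : realType) (q : R) : poisson_tail 0 q = 1 - expR (- q).
Proof. by rewrite /poisson_tail big_ord1 expr0 fact0 divr1 mulr1. Qed.

Lemma poisson_tailS (R : realType) (k : nat) (q : R) :
  poisson_tail k.+1 q = poisson_tail k q - expR (- q) * (q ^+ k.+1 / k.+1`!%:R).
Proof. by rewrite /poisson_tail big_ord_recr/= mulrDr opprD addrA. Qed.

Lemma poisson_tail_at0 (R : realType) (k : nat) : poisson_tail k (0 : R) = 0.
Proof.
elim: k => [|k IHk]; first by rewrite poisson_tail0 oppr0 expR0 subrr.
by rewrite poisson_tailS IHk exprS !mul0r mulr0 subr0.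
Qed.

Lemma is_derive_expRN (R : realType) (q : R) :
  is_derive q 1 (fun x : R => expR (- x)) (- expR (- q)).
Proof.
have Nq : is_derive q 1 (fun x : R => - x) (-1) by exact: is_deriveN.
apply: (is_derive_eq (is_derive1_comp (is_derive_expR (- q)) Nq)).
exact: mulrN1.
Qed.

Lemma is_derive_exprn (R : realType) (n : nat) (x : R) :
  is_derive x 1 (fun y : R => y ^+ n) (n%:R * x ^+ n.-1).
Proof.
have -> : (fun y : R => y ^+ n) = id ^+ n.
  by apply/funext => y; rewrite exprfctE.
by apply: (is_derive_eq (is_deriveX n (is_derive_id x 1))); exact: mulr1.
Qed.

Lemma natr_fact_neq0 (R : realType) n : n`!%:R != 0 :> R.
Proof. by rewrite pnatr_eq0 -lt0n fact_gt0. Qed.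

(** The term subtracted in [poisson_tailS] has derivative [e^{-q} (q^k / k! - q^{k+1} / (k+1)!)],
    whose first part cancels the derivative of the tail at [k]. *)
Lemma is_derive_poisson_tail (R : realType) (k : nat) (q : R) :
  is_derive q 1 (@poisson_tail R k) (expR (- q) * (q ^+ k / k`!%:R)).
Proof.
elim: k => [|k IHk].
  have -> : @poisson_tail R 0 = cst 1 - (fun x => expR (- x)).
    by apply/funext => x; rewrite poisson_tail0.
  apply: (is_derive_eq (is_deriveB (is_derive_cst _ _ _) (is_derive_expRN q))).
  by rewrite sub0r opprK expr0 fact0 divr1 mulr1.
have -> : @poisson_tail R k.+1 =
    @poisson_tail R k - (fun x => expR (- x)) * (k.+1`!%:R^-1 *: (fun x => x ^+ k.+1)).
  apply/funext => x; rewrite poisson_tailS; congr (_ - _ * _); exact: mulrC.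
apply: (is_derive_eq (is_deriveB IHk (is_deriveM (is_derive_expRN q)
  (is_deriveZ (k.+1`!%:R^-1) (@is_derive_exprn R k.+1 q))))).
rewrite /GRing.scale/= -[_ *: _]/(_ * _) factS natrM.
have := natr_fact_neq0 R k; have : k.+1%:R != 0 :> R by rewrite pnatr_eq0.
by move=> ? ?; field; rewrite nat1r; apply/andP.
Qed.

Lemma poisson_tail_ge0 (R : realType) (k : nat) (q : R) : 0 <= q -> 0 <= poisson_tail k q.
Proof.
move=> q0; have [c [_ c0 +]] := mean_value_from0 q (@is_derive_poisson_tail R k).
rewrite poisson_tail_at0 subr0 => ->.
by rewrite !mulr_ge0 ?expR_ge0 ?exprn_ge0 ?c0.
Qed.

(** The gap between the two sides vanishes at 0 and has derivative [(1 - e^{-q}) q^k / k!], which is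
    nonnegative for [q >= 0]. *)
Lemma poisson_tail_le_monomial (R : realType) (k : nat) (q : R) :
  0 <= q -> poisson_tail k q <= q ^+ k.+1 / k.+1`!%:R.
Proof.
move=> q0.
have [c [_ c0]] := mean_value_from0 q (fun x => is_deriveB
  (is_deriveZ k.+1`!%:R^-1 (@is_derive_exprn R k.+1 x)) (is_derive_poisson_tail k x)).
rewrite !fctE /= /GRing.scale/= poisson_tail_at0.
rewrite expr0n/= mulr0 !subr0 => E.
rewrite mulrC -subr_ge0 E mulr_ge0//.
have -> : k.+1`!%:R^-1 * (k.+1%:R * c ^+ k) = 1 * (c ^+ k / k`!%:R).
  rewrite factS natrM; have := natr_fact_neq0 R k.
  have : k.+1%:R != 0 :> R by rewrite pnatr_eq0.
  by move=> ? ?; field; rewrite nat1r; apply/andP.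
rewrite -mulrBl mulr_ge0 ?divr_ge0 ?exprn_ge0 ?c0//.
by rewrite subr_ge0 expR_le1 oppr_le0 c0.
Qed.

(** By the monomial bound, the term subtracted in passing from [k] to [k+1] is at least [e^{-q}]
    times the tail at [k], so each step gains a factor [1 - e^{-q}]. *)
Lemma poisson_tail_le_expr (R : realType) (k : nat) (q : R) :
  0 <= q -> poisson_tail k q <= (1 - expR (- q)) ^+ k.+1.
Proof.
move=> q0; have e1 : 0 <= 1 - expR (- q).
  by rewrite subr_ge0 expR_le1 oppr_le0.
elim: k => [|k IHk]; first by rewrite poisson_tail0 expr1.
rewrite exprSr; apply: le_trans (ler_wpM2r e1 IHk).
rewrite poisson_tailS mulrBr mulr1 lerB//.
by rewrite mulrC ler_wpM2l ?expR_ge0// poisson_tail_le_monomial.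
Qed.

(** From [e^x >= 1 + x^{k+1} / (k+1)!] the function is at most [(k+1) / x] for [x > 0], and is
    squeezed to 0. *)
Lemma cvgy_expRN_mul_exprn (R : realType) (k : nat) :
  expR (- x) * (x ^+ k / k`!%:R) @[x --> +oo] --> (0 : R).
Proof.
have H : k.+1%:R * x^-1 @[x --> +oo] --> (0 : R).
  rewrite -[X in _ --> X](mulr0 k.+1%:R); apply: cvgM; first exact: cvg_cst.
  by apply/gtr0_cvgV0 => //; exact: nbhs_pinfty_gt.
apply: (squeeze_cvgr _ (cvg_cst 0) H).
near=> x.
have x0 : 0 < x by near: x; exact: nbhs_pinfty_gt.
apply/andP; split.
  by rewrite mulr_ge0 ?expR_ge0// divr_ge0// exprn_ge0// ltW.
have e0 := expR_gt0 (- x).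
have : expR (- x) * (x ^+ k.+1 / k.+1`!%:R) <= 1.
  have := ler_wpM2l (ltW e0) (expR_ge1Dxn k (ltW x0)).
  rewrite (mulrC _ (expR x)) expRxMexpNx_1 mulrDr mulr1; apply: le_trans.
  by rewrite lerDr ltW.
have c0 : 0 <= k.+1%:R * x^-1 by rewrite mulr_ge0// invr_ge0 ltW.
move=> /(ler_wpM2l c0); rewrite mulr1; apply: le_trans.
rewrite le_eqVlt; apply/orP; left; apply/eqP.
rewrite factS natrM exprS; have := natr_fact_neq0 R k.
have : k.+1%:R != 0 :> R by rewrite pnatr_eq0.
by move=> ? ?; field; rewrite nat1r (gt_eqF x0); apply/and3P.
Unshelve. all: by end_near. Qed.

Lemma cvgy_poisson_tail (R : realType) (k : nat) :
  @poisson_tail R k x @[x --> +oo] --> (1 : R).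
Proof.
elim: k => [|k IHk].
  rewrite -[X in _ --> X](subr0 1).
  have -> : @poisson_tail R 0 = (fun x => 1 - expR (- x)).
    by apply/funext => x; rewrite poisson_tail0.
  by apply: cvgB; [exact: cvg_cst|exact: cvgr_expR].
rewrite -[X in _ --> X](subr0 1).
have -> : @poisson_tail R k.+1 =
    (fun x => poisson_tail k x - expR (- x) * (x ^+ k.+1 / k.+1`!%:R)).
  by apply/funext => x; rewrite poisson_tailS.
by apply: cvgB => //; exact: cvgy_expRN_mul_exprn.
Qed.

Lemma continuous_gamma_integrand (R : realType) (k : nat) :
  continuous (fun t : R => t ^+ k * expR (- t)).
Proof.
move=> x; apply: cvgM; first exact: exprn_continuous.
by apply: (is_derive_continuous (@is_derive_expRN R)).
Qed.

(** Supplies an antiderivative of the integrand of [Gamma] at [k+1] that vanishes at 0 and, by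
    [cvgy_poisson_tail], tends to [k!]. *)
Lemma is_derive_factM_poisson_tail (R : realType) (k : nat) (x : R) :
  is_derive x 1 (fun t => k`!%:R * poisson_tail k t) (x ^+ k * expR (- x)).
Proof.
apply: (is_derive_eq (is_deriveZ k`!%:R (is_derive_poisson_tail k x))).
rewrite /GRing.scale/= mulrCA [k`!%:R * _]mulrC divfK ?natr_fact_neq0//.
exact: mulrC.
Qed.

Lemma GammaS (R : realType) (k : nat) : Gamma k.+1%:R = k`!%:R :> R.
Proof.
rewrite /Gamma -natr1 addrK.
pose f (t : R) : R := t ^+ k * expR (- t); pose F (t : R) : R := k`!%:R * poisson_tail k t.
have dF (x : R) : is_derive x 1 F (f x) by exact: is_derive_factM_poisson_tail.
transitivity (\int[lebesgue_measure]_(t in `]0, +oo[) f t).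
  apply: eq_Rintegral => t; rewrite inE/= in_itv/= andbT => t0.
  by rewrite powR_mulrn// ltW.
have cf : continuous f := @continuous_gamma_integrand R k.
(* The null point 0 is added to the interval to match the closed left end in the fundamental
   theorem. *)
rewrite /Rintegral integral_itv_obnd_cbnd; last first.
  apply/measurable_EFinP/measurable_funTS; exact: continuous_measurable_fun.
rewrite (@ge0_continuous_FTC2y _ f F 0 k`!%:R).
- by rewrite /F poisson_tail_at0 mulr0 sube0.
- by move=> x x0; rewrite mulr_ge0 ?exprn_ge0 ?expR_ge0.
- exact: continuous_subspaceT.
- rewrite -[X in _ --> X]mulr1; by apply: cvgM; [exact: cvg_cst|exact: cvgy_poisson_tail].
- by move=> x _; exact: (@ex_derive _ _ _ _ _ _ _ (dF x)).
- by apply: cvg_at_right_filter; exact: (is_derive_continuous dF).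
- by move=> x _; rewrite derive1E; exact: (@derive_val _ _ _ _ _ _ _ (dF x)).
Qed.

Lemma gammaPS (R : realType) (k : nat) (q : R) :
  0 <= q -> gammaP k.+1%:R q = poisson_tail k q.
Proof.
rewrite /gammaP GammaS -natr1 addrK le_eqVlt => /predU1P[<-|q0].
  (* At [q = 0] the interval is empty; the fundamental theorem used below needs [0 < q]. *)
  by rewrite set_itvoc0 Rintegral_set0 mulr0 poisson_tail_at0.
pose f (t : R) : R := t ^+ k * expR (- t); pose F (t : R) : R := k`!%:R * poisson_tail k t.
have dF (x : R) : is_derive x 1 F (f x) by exact: is_derive_factM_poisson_tail.
have cf : continuous f := @continuous_gamma_integrand R k.
have -> : \int[lebesgue_measure]_(t in `]0, q]) (t `^ k%:R * expR (- t)) =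
    \int[lebesgue_measure]_(t in `]0, q]) f t.
  apply: eq_Rintegral => t; rewrite inE/= in_itv/= => /andP[t0 _].
  by rewrite powR_mulrn// ltW.
rewrite /Rintegral integral_itv_obnd_cbnd; last first.
  apply/measurable_EFinP/measurable_funTS; exact: continuous_measurable_fun.
rewrite (@continuous_FTC2 _ f F 0 q q0).
- by rewrite /F poisson_tail_at0 mulr0 sube0/= mul1r mulKf ?natr_fact_neq0.
- exact: continuous_subspaceT.
- split; first by move=> x _; exact: (@ex_derive _ _ _ _ _ _ _ (dF x)).
    by apply: cvg_at_right_filter; exact: (is_derive_continuous dF).
  by apply: cvg_at_left_filter; exact: (is_derive_continuous dF).
- by move=> x _; rewrite derive1E; exact: (@derive_val _ _ _ _ _ _ _ (dF x)).
Qed.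

(** * Gaussian integrals *)

(** Up to a constant this is the centred normal density of variance [1 / (2c)]. *)
Lemma integrable_expRN_sqr (R : realType) (c : R) : 0 < c ->
  (@lebesgue_measure R).-integrable setT (EFin \o fun t => expR (- (c * t ^+ 2))).
Proof.
move=> c0; pose s := Num.sqrt ((c *+ 2)^-1).
have s2 : s ^+ 2 = (c *+ 2)^-1 by rewrite sqr_sqrtr// invr_ge0 mulrn_wge0// ltW.
have s0 : s != 0 by rewrite gt_eqF// sqrtr_gt0 invr_gt0 pmulrn_lgt0.
have := integrableZl measurableT (normal_peak s)^-1 (integrable_normal_pdf 0 s).
apply: eq_integrable => // t _; rewrite /= normal_pdfE// -EFinM.
rewrite mulKf ?gt_eqF ?normal_peak_gt0// /normal_fun subr0 s2.
congr (expR _)%:E; field.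
by rewrite gt_eqF.
Qed.

Definition gauss_weight (R : realType) (t : R) : R := expR (- (t ^+ 2) / 2).

Definition gauss_primitive (R : realType) (x : R) : R :=
  \int[lebesgue_measure]_(t in `]-oo, x]) gauss_weight t.

Lemma gauss_weightE (R : realType) (t : R) : gauss_weight t = expR (- (2^-1 * t ^+ 2)).
Proof. by congr expR; rewrite mulNr mulrC. Qed.

Lemma is_derive_expRN_sqr (R : realType) (c x : R) :
  is_derive x 1 (fun t : R => expR (- (c * t ^+ 2)))
    (- (c * (2 * x)) * expR (- (c * x ^+ 2))).
Proof.
have H : is_derive x 1 (fun t : R => - (c * t ^+ 2)) (- (c * (2 * x))).
  exact: is_deriveN (is_deriveZ c (is_derive_exprn 2 x)).
apply: (is_derive_eq (@is_derive1_comp R expR _ _ _ _ (is_derive_expR _) H)).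
exact: mulrC.
Qed.

Lemma continuous_expRN_sqr (R : realType) (c : R) :
  continuous (fun t : R => expR (- (c * t ^+ 2))).
Proof. exact: is_derive_continuous (@is_derive_expRN_sqr R c). Qed.

Lemma integrable_gauss_weight (R : realType) (A : set R) : measurable A ->
  (@lebesgue_measure R).-integrable A (EFin \o @gauss_weight R).
Proof.
move=> mA; apply: (integrableS measurableT) => //.
have -> : @gauss_weight R = fun t => expR (- (2^-1 * t ^+ 2)).
  by apply/funext => t; rewrite gauss_weightE.
by apply: integrable_expRN_sqr; rewrite invr_gt0.
Qed.

Lemma continuous_gauss_weight (R : realType) : continuous (@gauss_weight R).
Proof.
have -> : @gauss_weight R = fun t => expR (- (2^-1 * t ^+ 2)).
  by apply/funext => t; rewrite gauss_weightE.
exact: continuous_expRN_sqr.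
Qed.

Lemma integral_gauss_weight (R : realType) :
  (\int[@lebesgue_measure R]_t (gauss_weight t)%:E)%E = (Num.sqrt (2 * pi))%:E.
Proof.
have := @integral_normal_pdf R 0 1.
have -> : (fun x : R => (normal_pdf 0 1 x)%:E) =
    (fun x => ((Num.sqrt (2 * pi))^-1)%:E * (gauss_weight x)%:E)%E.
  apply/funext => x; rewrite normal_pdfE ?oner_neq0// -EFinM.
  rewrite /normal_peak /normal_fun /gauss_weight subr0 expr1n mul1r; congr (_ * _)%:E.
  by rewrite mulr_natl.
rewrite integralZl//; last exact: integrable_gauss_weight.
have s0 : Num.sqrt (2 * pi) != 0 :> R by rewrite gt_eqF// sqrtr_gt0 mulr_gt0 ?pi_gt0.
move=> /(congr1 (fun y => (Num.sqrt (2 * pi))%:E * y)%E).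
by rewrite muleA -EFinM mulfV// mul1e mule1.
Qed.

Lemma gauss_weight_even (R : realType) (t : R) : gauss_weight (- t) = gauss_weight t.
Proof. by rewrite /gauss_weight sqrrN. Qed.

(** Evenness makes the half-line integral half of the full Gaussian integral. *)
Lemma gauss_primitive0 (R : realType) : gauss_primitive 0 = Num.sqrt (2 * pi) / 2 :> R.
Proof.
have T : (2%:E * \int[@lebesgue_measure R]_(t in `[0%R, +oo[) (gauss_weight t)%:E =
    (Num.sqrt (2 * pi))%:E)%E.
  rewrite -integral_gauss_weight ge0_symfun_integralT -?set_itvcy//.
  - by move=> x; rewrite expR_ge0.
  - exact: continuous_gauss_weight.
  - by move=> x /=; rewrite gauss_weight_even.
rewrite /gauss_primitive /Rintegral -[in LHS]oppr0.
rewrite ge0_integration_by_substitutionNy; last 2 first.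
- exact: continuous_subspaceT (@continuous_gauss_weight R).
- by move=> x _; rewrite expR_ge0.
under eq_integral do rewrite /= gauss_weight_even.
(* Finiteness lets the extended-real identity [T] be solved for a real value. *)
have : (\int[@lebesgue_measure R]_(t in `[0%R, +oo[) (gauss_weight t)%:E \is a fin_num)%E.
  by apply: integrable_fin_num => //; exact: integrable_gauss_weight.
move: (\int[lebesgue_measure]_(t in _) _)%E T => -[r| |]//= + _.
by rewrite -EFinM => -[<-]; rewrite mulrC mulKf.
Qed.

Lemma is_derive_Rintegral_Ny (R : realType) (f : R -> R) (x : R) :
  (@lebesgue_measure R).-integrable setT (EFin \o f) -> continuous f ->
  is_derive x 1 (fun y => \int[lebesgue_measure]_(t in `]-oo, y]) f t) (f x).
Proof.
move=> fi cf; have [] := @continuous_FTC1 R f -oo%O x (x + 1) _ _ _ (cf x).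
- by rewrite ltrDl.
- exact: integrableS fi.
- by rewrite ltNyr.
by move=> dF dFE; apply: DeriveDef; [exact: dF|rewrite -derive1E; exact: dFE].
Qed.

Lemma is_derive_gauss_primitive (R : realType) (x : R) :
  is_derive x 1 (@gauss_primitive R) (gauss_weight x).
Proof.
apply: is_derive_Rintegral_Ny; last exact: continuous_gauss_weight.
exact: integrable_gauss_weight.
Qed.

Lemma gauss_primitive_bound (R : realType) (x : R) :
  `|gauss_primitive x| <= Num.sqrt (2 * pi).
Proof.
rewrite ger0_norm; last by apply: Rintegral_ge0 => t _; exact: expR_ge0.
rewrite -lee_fin -integral_gauss_weight /gauss_primitive /Rintegral fineK; last first.
  by apply: integrable_fin_num => //; exact: integrable_gauss_weight.
apply: ge0_subset_integral => //.
- by apply/measurable_EFinP; apply: continuous_measurable_fun (@continuous_gauss_weight R).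
- by move=> t _; rewrite lee_fin expR_ge0.
Qed.

(** Half of the exponent is spent on absorbing [|t|]: [|t| <= 1 + t^2 <= (1 + 2/c) (1 + c t^2 / 2)
    <= (1 + 2/c) e^{c t^2 / 2}]. *)
Lemma normM_expRN_sqr_le (R : realType) (c t : R) : 0 < c ->
  `|t * expR (- (c * t ^+ 2))| <= (1 + 2 / c) * expR (- (c / 2 * t ^+ 2)).
Proof.
move=> c0; rewrite normrM (ger0_norm (expR_ge0 _)).
have -> : - (c * t ^+ 2) = - (c / 2 * t ^+ 2) + - (c / 2 * t ^+ 2) by field.
rewrite expRD mulrA ler_wpM2r ?expR_ge0//.
have e := expR_ge1Dx (c / 2 * t ^+ 2).
rewrite expRN ler_pdivrMr ?expR_gt0//.
have d0 : 0 < 1 + 2 / c by rewrite addr_gt0// divr_gt0.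
apply: (le_trans _ (ler_wpM2l (ltW d0) e)).
have -> : (1 + 2 / c) * (1 + c / 2 * t ^+ 2) =
    1 + t ^+ 2 + (2 / c + c / 2 * t ^+ 2) by field; rewrite gt_eqF.
have t2 : 0 <= t ^+ 2 by rewrite sqr_ge0.
have : `|t| <= 1 + t ^+ 2 by rewrite -real_normK ?num_real//; nra.
have c_ge0 := ltW c0.
by move=> /le_trans; apply; rewrite lerDl addr_ge0 ?divr_ge0// mulr_ge0 ?divr_ge0.
Qed.

Lemma continuous_idM_expRN_sqr (R : realType) (c : R) :
  continuous (fun t : R => t * expR (- (c * t ^+ 2))).
Proof. by move=> x; apply: cvgM; [exact: cvg_id|exact: continuous_expRN_sqr]. Qed.

Lemma integrable_idM_expRN_sqr (R : realType) (c : R) : 0 < c ->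
  (@lebesgue_measure R).-integrable setT
    (EFin \o fun t => t * expR (- (c * t ^+ 2))).
Proof.
move=> c0; have c20 : 0 < c / 2 by rewrite divr_gt0.
have := integrableZl measurableT (1 + 2 / c) (integrable_expRN_sqr c20).
apply: le_integrable => //.
  apply/measurable_EFinP; apply: continuous_measurable_fun.
  exact: continuous_idM_expRN_sqr.
move=> t _; rewrite /= lee_fin (le_trans (normM_expRN_sqr_le t c0))//.
by rewrite ler_norm.
Qed.

Lemma is_derive_expRN_sqr_primitive (R : realType) (c x : R) : c != 0 ->
  is_derive x 1 (fun t : R => - (2 * c)^-1 * expR (- (c * t ^+ 2)))
    (x * expR (- (c * x ^+ 2))).
Proof.
move=> c0.
apply: (is_derive_eq (is_deriveZ (- (2 * c)^-1) (is_derive_expRN_sqr c x))).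
rewrite /GRing.scale/=; field.
by rewrite c0.
Qed.

(** The reflection [t -> -t] leads to the integral of [t e^{-c t^2}] over the positive half-line,
    which has an explicit antiderivative. *)
Lemma integral_Ny0_idM_expRN_sqr (R : realType) (c : R) : 0 < c ->
  \int[lebesgue_measure]_(t in `]-oo, 0]) (- t * expR (- (c * t ^+ 2))) =
    (2 * c)^-1.
Proof.
move=> c0; pose g (t : R) := t * expR (- (c * t ^+ 2)).
have cg : continuous g := @continuous_idM_expRN_sqr R c.
have cn0 : c != 0 by rewrite gt_eqF.
pose F (t : R) := - (2 * c)^-1 * expR (- (c * t ^+ 2)).
have dF (x : R) : is_derive x 1 F (g x) := is_derive_expRN_sqr_primitive x cn0.
rewrite /Rintegral -[in LHS]oppr0 ge0_integration_by_substitutionNy; last 2 first.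
- apply: continuous_subspaceT => x; under eq_fun do rewrite mulNr.
  by apply: cvgN; exact: cg.
- move=> x; rewrite in_itv/= oppr0 => x0.
  by rewrite mulr_ge0 ?expR_ge0// oppr_ge0 ltW.
under eq_integral do rewrite /= sqrrN opprK.
rewrite (@ge0_continuous_FTC2y _ g F 0 0).
- by rewrite sub0e /F expr0n/= mulr0 oppr0 expR0 mulr1 opprK.
- by move=> x x0; rewrite mulr_ge0 ?expR_ge0.
- exact: continuous_subspaceT.
- rewrite -[X in _ --> X](mulr0 (- (2 * c)^-1)).
  apply: cvgM; first exact: cvg_cst.
  have H : c * x ^+ 2 @[x --> +oo] --> +oo.
    under eq_fun do rewrite mulrC.
    by apply: gt0_cvgMly => //; exact: cvgr_expr2.
  exact: (cvg_comp _ (fun y => expR (- y)) H (@cvgr_expR R)).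
- by move=> x _; exact: (@ex_derive _ _ _ _ _ _ _ (dF x)).
- by apply: cvg_at_right_filter; exact: (is_derive_continuous dF).
- by move=> x _; rewrite derive1E; exact: (@derive_val _ _ _ _ _ _ _ (dF x)).
Qed.

(** The integrand changes sign at 0, so the fundamental theorem for nonnegative functions settles
    only [h = 0]. For other [h], the integral minus its closed form has zero derivative in [h]. *)
Lemma integral_Ny_idM_expRN_sqr (R : realType) (c h : R) : 0 < c ->
  \int[lebesgue_measure]_(t in `]-oo, h]) (- t * expR (- (c * t ^+ 2))) =
    (2 * c)^-1 * expR (- (c * h ^+ 2)).
Proof.
move=> c0; have cn0 : c != 0 by rewrite gt_eqF.
pose f (t : R) := - t * expR (- (c * t ^+ 2)).
have fE : f = (fun t => -1 * (t * expR (- (c * t ^+ 2)))).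
  by apply/funext => t; rewrite /f mulN1r mulNr.
have cf : continuous f.
  rewrite fE => x; apply: cvgM; first exact: cvg_cst.
  exact: continuous_idM_expRN_sqr.
have fi : (@lebesgue_measure R).-integrable setT (EFin \o f).
  rewrite fE; have := integrable_idM_expRN_sqr c0.
  by move=> /(integrableZl measurableT (-1)).
have dW (x : R) := is_deriveD (is_derive_Rintegral_Ny x fi cf)
  (is_derive_expRN_sqr_primitive x cn0).
have dW0 x : is_derive x (1 : R) ((fun y => \int[lebesgue_measure]_(t in `]-oo, y]) f t)
    + (fun t => - (2 * c)^-1 * expR (- (c * t ^+ 2)))) 0.
  by apply: (is_derive_eq (dW x)); rewrite /f mulNr addNr.
have := is_derive_0_is_cst h 0 dW0.
rewrite !fctE integral_Ny0_idM_expRN_sqr// expr0n/= mulr0 oppr0 expR0 mulr1.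
by rewrite subrr mulNr => /eqP; rewrite subr_eq0 => /eqP.
Qed.

(** * Reduction of the bivariate integral, and its derivative in [r] *)

Lemma integral_bivariate_inner (R : realType) (rho t : R) : -1 < rho < 1 ->
  \int[lebesgue_measure]_(s in `]-oo, 0])
    expR (- ((s ^+ 2 - 2 * rho * s * t + t ^+ 2) / (2 * (1 - rho ^+ 2)))) =
  Num.sqrt (1 - rho ^+ 2) *
    (gauss_weight t * gauss_primitive (- (rho / Num.sqrt (1 - rho ^+ 2) * t))).
Proof.
move=> rho1; set o := 1 - rho ^+ 2; set sg := Num.sqrt o.
have o0 : 0 < o by rewrite subr_gt0 -real_normK ?num_real// expr_lt1// ltr_norml.
have sg0 : 0 < sg by rewrite sqrtr_gt0.
have sgn0 : sg != 0 by rewrite gt_eqF.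
have sg2 : sg ^+ 2 = o by rewrite sqr_sqrtr// ltW.
(* Completing the square, [s^2 - 2 rho s t + t^2 = (s - rho t)^2 + (1 - rho^2) t^2], singles out
   this affine substitution. *)
pose F (s : R) := (s + (- (rho * t))) * sg^-1.
have dF (x : R) : is_derive x 1 F sg^-1.
  apply: (is_derive_eq (is_deriveM (is_deriveD (is_derive_id x 1)
    (is_derive_cst (- (rho * t)) x 1)) (is_derive_cst sg^-1 x 1))).
  by rewrite addr0 /GRing.scale/= mulr1 mulr0 add0r.
have F'E : F^`()%classic = cst sg^-1.
  apply/funext => x; rewrite derive1E.
  by rewrite (@derive_val _ _ _ _ _ _ _ (dF x)).
have -> : - (rho / sg * t) = F 0 by rewrite /F add0r mulrAC mulNr.
transitivity (\int[lebesgue_measure]_(s in `]-oo, 0])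
    (sg * gauss_weight t * (gauss_weight (F s) * sg^-1))).
  apply: eq_Rintegral => s _; rewrite (mulrC (gauss_weight (F s))).
  rewrite mulrACA mulfV// mul1r -expRD.
  congr expR; rewrite /F exprMn exprVn sg2.
  rewrite /o; field.
  by rewrite gt_eqF.
have cF : continuous (@gauss_weight R \o F).
  move=> x; apply: continuous_comp; last exact: continuous_gauss_weight.
  exact: (is_derive_continuous dF).
have S : (\int[lebesgue_measure]_(s in `]-oo, F 0%R]) (gauss_weight s)%:E =
    \int[lebesgue_measure]_(s in `]-oo, 0%R]) (gauss_weight (F s) * sg^-1)%:E)%E.
  rewrite increasing_ge0_integration_by_substitutionNy.
  - by rewrite F'E.
  - by move=> x y _ _ xy; rewrite ltr_pM2r ?invr_gt0// ltrD2r.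
  - by rewrite F'E => x _; exact: cvg_cst.
  - by rewrite F'E; exact: is_cvg_cst.
  - by rewrite F'E; exact: cvg_cst.
  - split; first by move=> x _; exact: (@ex_derive _ _ _ _ _ _ _ (dF x)).
    by apply: cvg_at_left_filter; exact: (is_derive_continuous dF).
  - by apply: gt0_cvgMlNy; [rewrite invr_gt0|exact: cvg_addrr_Ny].
  - exact: continuous_subspaceT (@continuous_gauss_weight R).
  - by move=> x _; exact: expR_ge0.
rewrite /gauss_primitive mulrA [in RHS]/Rintegral S -RintegralZl//.
(* Pulling the constant out of the integral requires integrability. It follows from [S]: the
   transformed integral is at most the full Gaussian one. *)
apply/integrableP; split.
  apply/measurable_EFinP/measurable_funTS; apply: continuous_measurable_fun => x.
  by apply: cvgM; [exact: cF|exact: cvg_cst].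
have g0 s : 0 <= gauss_weight (F s) * sg^-1 by rewrite mulr_ge0 ?expR_ge0 ?invr_ge0// ltW.
under eq_integral do rewrite /= ger0_norm ?g0//.
rewrite -S; apply: (@le_lt_trans _ _ (Num.sqrt (2 * pi))%:E); last exact: ltry.
rewrite -integral_gauss_weight; apply: ge0_subset_integral => //.
- by apply/measurable_EFinP; apply: continuous_measurable_fun (@continuous_gauss_weight R).
- by move=> s _; rewrite lee_fin expR_ge0.
Qed.

(* [2 pi] times the bivariate normal probability of [X <= h, Y <= 0] with correlation
   [r / sqrt (1 + r^2)]. *)
Definition owen_integral (R : realType) (h r : R) : R :=
  \int[lebesgue_measure]_(t in `]-oo, h]) (gauss_weight t * gauss_primitive (- (r * t))).

Lemma owen_integral0 (R : realType) (h : R) :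
  owen_integral h 0 = Num.sqrt (2 * pi) / 2 * gauss_primitive h.
Proof.
rewrite /owen_integral /gauss_primitive -RintegralZl//; last exact: integrable_gauss_weight.
apply: eq_Rintegral => t _; rewrite mul0r oppr0 -/(gauss_primitive 0) gauss_primitive0.
exact: mulrC.
Qed.

Lemma integrable_owen_integral (R : realType) (r h : R) :
  (@lebesgue_measure R).-integrable `]-oo, h]
    (EFin \o fun t => gauss_weight t * gauss_primitive (- (r * t))).
Proof.
have cD : continuous (fun t : R => gauss_primitive (- (r * t))).
  move=> x; apply: (@continuous_comp _ _ _ (fun t => - (r * t)) (@gauss_primitive R)).
    by apply: cvgN; apply: cvgM; [exact: cvg_cst|exact: cvg_id].
  exact: (is_derive_continuous (@is_derive_gauss_primitive R)).
have gi : (@lebesgue_measure R).-integrable `]-oo, h] (EFin \o @gauss_weight R).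
  exact: integrable_gauss_weight.
have gM := integrableMl _ gi; apply: gM => //.
  by apply: measurable_funTS; exact: continuous_measurable_fun.
exists (Num.sqrt (2 * pi)); split; first exact: num_real.
by move=> M ltM t _; rewrite /= (le_trans (gauss_primitive_bound _))// ltW.
Qed.

(** Differentiation under the integral sign gives the integrand [- t e^{-(1 + r^2) t^2 / 2}], to
    which [integral_Ny_idM_expRN_sqr] applies with [c = (1 + r^2) / 2]. *)
Lemma is_derive_owen_integral (R : realType) (h r : R) :
  is_derive r 1 (owen_integral h)
    (expR (- (1 / 2 * (1 + r ^+ 2) * h ^+ 2)) / (1 + r ^+ 2)).
Proof.
pose f (x t : R) := gauss_weight t * gauss_primitive (- (x * t)).
have df (x t : R) : is_derive x 1 (f ^~ t) (gauss_weight t * (gauss_weight (- (x * t)) * - t)).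
  have H : is_derive x 1 (fun y : R => - (y * t)) (- t).
    apply: (is_derive_eq (is_deriveN (is_deriveM (is_derive_id x 1)
      (is_derive_cst t x 1)))).
    by rewrite /GRing.scale/= mulr0 mulr1 add0r.
  exact: (is_deriveZ (gauss_weight t) (@is_derive1_comp R (@gauss_primitive R) _ _ _ _
    (is_derive_gauss_primitive _) H)).
have ri : `]r - 1, r + 1[%classic r.
  by rewrite /= in_itv/= ltrDl ltrBlDr ltrDl ltr01.
have intf x : `]r - 1, r + 1[%classic x ->
    (@lebesgue_measure R).-integrable `]-oo, h] (EFin \o f x).
  by move=> _; exact: integrable_owen_integral.
have derf x t : `]r - 1, r + 1[%classic x -> `]-oo, h]%classic t ->
    derivable (f ^~ t) x 1.
  by move=> _ _; exact: (@ex_derive _ _ _ _ _ _ _ (df x t)).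
(* A dominating function independent of [x], since [gauss_weight (- (x * t)) <= 1]; the radius 1 of
   the neighbourhood of [r] is therefore arbitrary. *)
pose G (t : R) := `|t * expR (- (2^-1 * t ^+ 2))|.
have intG : (@lebesgue_measure R).-integrable `]-oo, h] (EFin \o G).
  have G1 := @integrable_idM_expRN_sqr R 2^-1.
  apply: (integrableS measurableT) => //.
  by apply: (integrable_norm (G1 _)); rewrite invr_gt0.
have dfE x t : partial1of2 f x t = gauss_weight t * (gauss_weight (- (x * t)) * - t).
  by rewrite /partial1of2 derive1E; exact: (@derive_val _ _ _ _ _ _ _ (df x t)).
have ubG x t : `]r - 1, r + 1[%classic x -> `]-oo, h]%classic t ->
    `|partial1of2 f x t| <= G t.
  move=> _ _; rewrite dfE /G -gauss_weightE mulrCA normrM mulrN normrN (mulrC t).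
  rewrite ler_piMl// ger0_norm ?expR_ge0// expR_le1 mulNr oppr_le0.
  by rewrite divr_ge0 ?sqr_ge0.
have D := @differentiation_under_integral R _ _ (@lebesgue_measure R) f _
  (measurable_itv `]-oo, h]) _ _ _ ri intf derf G (fun t => normr_ge0 _) intG ubG.
have D2 := @derivable_under_integral R _ _ (@lebesgue_measure R) f _
  (measurable_itv `]-oo, h]) _ _ _ ri intf derf G (fun t => normr_ge0 _) intG ubG.
apply: DeriveDef.
  exact: D2.
rewrite -derive1E [LHS]D.
have c0 : 0 < 1 + r ^+ 2 by rewrite ltr_pwDl ?sqr_ge0.
transitivity (\int[lebesgue_measure]_(t in `]-oo, h])
    (- t * expR (- (1 / 2 * (1 + r ^+ 2) * t ^+ 2)))).
  apply: eq_Rintegral => t _; rewrite dfE mulrCA mulrA mulrC; congr (_ * _).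
  by rewrite -expRD; congr expR; field.
rewrite (@integral_Ny_idM_expRN_sqr R (1 / 2 * (1 + r ^+ 2)) h) ?mulr_gt0//.
rewrite mulrC; congr (_ * _).
by field; rewrite gt_eqF.
Qed.

(** The factor [sqrt (1 - rho^2)] produced by the inner integral cancels the one in the
    normalization. *)
Lemma Phi2E (R : realType) (rho h : R) : -1 < rho < 1 ->
  Phi2 rho h 0 = owen_integral h (rho / Num.sqrt (1 - rho ^+ 2)) / (2 * pi).
Proof.
move=> rho1; rewrite /Phi2.
under eq_Rintegral do rewrite integral_bivariate_inner//.
have s0 : Num.sqrt (1 - rho ^+ 2) != 0.
  by rewrite gt_eqF// sqrtr_gt0 subr_gt0 -real_normK ?num_real// expr_lt1// ltr_norml.
rewrite RintegralZl//; last exact: integrable_owen_integral.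
rewrite -/(owen_integral h _).
have : pi != 0 :> R by rewrite gt_eqF ?pi_gt0.
by move: pi => p p0; field; rewrite s0 p0.
Qed.

Lemma PhiE (R : realType) (h : R) : 1 / 2 * Phi h = owen_integral h 0 / (2 * pi).
Proof.
rewrite /Phi -/(gauss_primitive h) owen_integral0.
have p0 : 0 < Num.sqrt (2 * pi) :> R by rewrite sqrtr_gt0 mulr_gt0 ?pi_gt0.
(* Here [2 * pi] becomes the square of its root, leaving a single atom for [field]. *)
rewrite -[X in _ = _ / X](@sqr_sqrtr _ (2 * pi)) ?mulr_ge0 ?pi_ge0//.
field.
by rewrite gt_eqF.
Qed.

(** * The telescoping series *)

(** Equal to the Wallis integral of [sin^{2k+1}] over [[0, pi/2]]. *)
Definition wallis (R : realType) (k : nat) : R :=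
  (double_fact (2 * k))%:R / (double_fact (2 * k + 1))%:R.

Lemma double_fact_gt0 n : (0 < double_fact n)%N.
Proof.
have [m] := ubnP n; elim: m n => // m IHm [|[|n]]// nm.
by rewrite /= muln_gt0/= IHm// -ltnS (ltn_trans _ nm).
Qed.

Lemma wallis0 (R : realType) : wallis R 0 = 1.
Proof. by rewrite /wallis muln0/= divr1. Qed.

Lemma wallis_ge0 (R : realType) (k : nat) : 0 <= wallis R k.
Proof. by rewrite divr_ge0. Qed.

(** Cross-multiplied, so that it rewrites the leading factor of [owen_rest] at [k.+1] directly. *)
Lemma wallisS (R : realType) (k : nat) :
  wallis R k.+1 * (2 * k.+1 + 1)%:R = wallis R k * (2 * k.+1)%:R.
Proof.
have E0 : double_fact (2 * k.+1) = (2 * k.+1 * double_fact (2 * k))%N.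
  by rewrite mulnS.
have E1 : double_fact (2 * k.+1 + 1) =
    ((2 * k.+1 + 1) * double_fact (2 * k + 1))%N by rewrite mulnS.
have b0 : (2 * k.+1 + 1)%:R != 0 :> R by rewrite addn1 pnatr_eq0.
have d0 : (double_fact (2 * k + 1))%:R != 0 :> R.
  by rewrite pnatr_eq0 -lt0n double_fact_gt0.
rewrite /wallis E0 E1 !natrM.
move: (2 * k.+1 + 1)%:R b0 (double_fact (2 * k + 1))%:R d0 => b b0 d d0.
by field; apply/andP.
Qed.

Lemma wallis_nonincreasing (R : realType) (m n : nat) :
  (m <= n)%N -> wallis R n <= wallis R m.
Proof.
move=> mn; rewrite -(subnKC mn); elim: (n - m)%N => [|j IHj]; first by rewrite addn0.
apply: le_trans IHj; rewrite addnS; set k := (m + j)%N.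
have k0 : 0 < (2 * k.+1 + 1)%:R :> R by rewrite addn1.
rewrite -(ler_pM2r k0) wallisS ler_wpM2l ?wallis_ge0// ler_nat.
by rewrite leq_addr.
Qed.

Lemma coef_wallis (R : realType) (q : R) (k : nat) :
  0 <= q -> coef q k = wallis R k * poisson_tail k q.
Proof. by move=> q0; rewrite /coef gammaPS. Qed.

Section OwenSeries.
Context {R : realType} (h : R).
Implicit Types r u : R.

Let q r := 1 / 2 * (1 + r ^+ 2) * h ^+ 2.

Definition owen_term k r :=
  wallis R k * (poisson_tail k (q r) * (r ^+ (2 * k + 1) * (1 + r ^+ 2)^-1 ^+ k.+1)).

(* The derivative of the remainder of the series after [k] terms. *)
Definition owen_rest k r :=
  wallis R k * (2 * k + 1)%:R *
  (poisson_tail k (q r) * (r ^+ (2 * k) * (1 + r ^+ 2)^-1 ^+ k.+1)).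

Let one_sqr_gt0 r : 0 < 1 + r ^+ 2.
Proof. by rewrite ltr_pwDl ?sqr_ge0. Qed.

Let q_ge0 r : 0 <= q r.
Proof. by rewrite mulr_ge0 ?sqr_ge0// mulr_ge0// ltW. Qed.

Let is_derive_one_sqr r : is_derive r 1 (fun u : R => 1 + u ^+ 2) (2 * r).
Proof.
have -> : (fun u => 1 + u ^+ 2) = cst 1 + (fun u : R => u ^+ 2) by [].
have H := is_deriveD (is_derive_cst (1 : R) r 1) (is_derive_exprn 2 r).
apply: (is_derive_eq H).
by rewrite add0r expr1.
Qed.

Let is_derive_q r : is_derive r 1 q (r * h ^+ 2).
Proof.
have qE : q = (1 / 2 * h ^+ 2) *: (fun u : R => 1 + u ^+ 2).
  by apply/funext => u; rewrite /q mulrAC.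
rewrite qE; apply: (is_derive_eq (is_deriveZ _ (is_derive_one_sqr r))).
by rewrite /GRing.scale/=; field.
Qed.

(** Since [r h^2 = 2 r q / (1 + r^2)], differentiating the tail yields [2 (k+1) r / (1 + r^2)] times
    its drop from [k] to [k+1]. Added to the derivative of the power of [(1 + r^2)^-1], this
    replaces the tail at [k] by the tail at [k+1], and [wallisS] turns the result into
    [- owen_rest k.+1 r]. The derivative of [r^{2k+1}] gives [owen_rest k r]. *)
Lemma is_derive_owen_term k r :
  is_derive r 1 (owen_term k) (owen_rest k r - owen_rest k.+1 r).
Proof.
have dP : is_derive r 1 (fun u => poisson_tail k (q u))
    (expR (- q r) * (q r ^+ k / k`!%:R) * (r * h ^+ 2)).
  exact: (@is_derive1_comp R (@poisson_tail R k) q _ _ _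
    (is_derive_poisson_tail k _) (is_derive_q r)).
have dV : is_derive r 1 (fun u : R => (1 + u ^+ 2)^-1)
    (- (1 + r ^+ 2) ^- 2 * (2 * r)).
  exact: (@is_deriveV R _ r _ 1 (lt0r_neq0 (one_sqr_gt0 r)) (is_derive_one_sqr r)).
have dVk : is_derive r 1 (fun u : R => (1 + u ^+ 2)^-1 ^+ k.+1)
    (k.+1%:R * (1 + r ^+ 2)^-1 ^+ k * (- (1 + r ^+ 2) ^- 2 * (2 * r))).
  exact: (@is_derive1_comp R (fun v => v ^+ k.+1) (fun u : R => (1 + u ^+ 2)^-1)
    _ _ _ (is_derive_exprn k.+1 _) dV).
apply: (is_derive_eq (is_deriveZ (wallis R k) (is_deriveM dP
  (is_deriveM (is_derive_exprn (2 * k + 1) r) dVk)))).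
rewrite /owen_rest wallisS poisson_tailS /GRing.scale/= !fctE.
rewrite factS !natrM natrD natrM mulnS (exprD _ 2) (exprD _ _ 1) addn1 expr1 /=.
rewrite !(exprSr _ k.+1) !(exprSr _ k).
have := natr_fact_neq0 R k; have := lt0r_neq0 (one_sqr_gt0 r).
have : k.+1%:R != 0 :> R by rewrite pnatr_eq0.
have -> : k.+1%:R = k%:R + 1 :> R by rewrite -natr1.
have -> : q r = 1 / 2 * (1 + r ^+ 2) * h ^+ 2 by [].
(* With all powers of exponent depending on [k] made atoms, a rational identity remains for
   [field]. *)
set Qk := (_ * h ^+ 2) ^+ k; set Vk := _^-1 ^+ k; set W := r ^+ (2 * k).
move: (wallis R k) (poisson_tail k _) (expR _) Qk Vk W (k`!)%:R => A p e Q V W kf.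
move: (k%:R : R) => k' k0 r0 kf0; field.
by apply/and3P.
Qed.

Lemma is_derive_owen_sum n r :
  is_derive r 1 (fun u => \sum_(k < n) owen_term k u)
    (owen_rest 0 r - owen_rest n r).
Proof.
elim: n => [|n IHn].
  have -> : (fun u => \sum_(k < 0) owen_term k u) = cst 0.
    by apply/funext => u; rewrite big_ord0.
  by rewrite subrr; exact: is_derive_cst.
have -> : (fun u => \sum_(k < n.+1) owen_term k u) =
    (fun u => \sum_(k < n) owen_term k u) + owen_term n.
  by apply/funext => u; rewrite big_ord_recr.
apply: (is_derive_eq (is_deriveD IHn (is_derive_owen_term n r))).
by rewrite addrA subrK.
Qed.

(** The first term [owen_rest 0] is [(1 - e^{-q}) / (1 + r^2)], the derivative of [atan] minus that
    of [owen_integral h], so only [owen_rest n] survives. *)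
Lemma is_derive_owen_remainder n r :
  is_derive r 1
    (fun u => atan u - owen_integral h u - \sum_(k < n) owen_term k u) (owen_rest n r).
Proof.
apply: (is_derive_eq (is_deriveB (is_deriveB (is_derive1_atan r)
  (is_derive_owen_integral h r)) (is_derive_owen_sum n r))).
rewrite -/(q r) /owen_rest wallis0 !muln0 poisson_tail0 expr0 !mul1r expr1.
by field; rewrite gt_eqF.
Qed.

(** Factor by factor: the Wallis ratio and the quotient of powers are at most 1, the tail obeys its
    monomial bound with [q u <= q r], and [(2n+1) / (n+1) <= 2]. What remains is a multiple of a
    term of the exponential series, hence tends to 0 with [n]. *)
Lemma owen_rest_le n r u : `|u| <= `|r| ->
  `|owen_rest n u| <= 2 * q r * exp_coeff (q r) n.
Proof.
move=> ur; have q0 := q_ge0 u; have one0 := one_sqr_gt0 u.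
have qle : q u <= q r.
  rewrite /q ler_wpM2r ?sqr_ge0// ler_wpM2l// lerD2l.
  by rewrite -(real_normK (num_real u)) -(real_normK (num_real r)) lerXn2r ?nnegrE.
have u2n0 : 0 <= u ^+ (2 * n) by rewrite exprM exprn_ge0 ?sqr_ge0.
have Vn0 : 0 <= (1 + u ^+ 2)^-1 ^+ n.+1 by rewrite exprn_ge0// invr_ge0 ltW.
rewrite ger0_norm; last first.
  by rewrite !mulr_ge0 ?wallis_ge0 ?poisson_tail_ge0.
(* This is [u^{2n} <= (1 + u^2)^n <= (1 + u^2)^{n+1}]. *)
have g1 : u ^+ (2 * n) * (1 + u ^+ 2)^-1 ^+ n.+1 <= 1.
  rewrite exprM exprVn ler_pdivrMr ?exprn_gt0// mul1r (exprS _ n).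
  have X0 : 0 <= (1 + u ^+ 2) ^+ n by rewrite exprn_ge0 ?ltW.
  apply: (@le_trans _ _ ((1 + u ^+ 2) ^+ n)).
    by rewrite lerXn2r ?nnegrE ?sqr_ge0 ?ltW// ltrDr.
  by rewrite ler_peMl// lerDl sqr_ge0.
have w1 : wallis R n * (2 * n + 1)%:R <= (2 * n + 1)%:R.
  by rewrite ler_piMl// -(wallis0 R) wallis_nonincreasing.
have p1 : poisson_tail n (q u) <= q r ^+ n.+1 / n.+1`!%:R.
  apply: (le_trans (poisson_tail_le_monomial n q0)).
  by rewrite ler_wpM2r ?invr_ge0// lerXn2r ?nnegrE.
apply: (@le_trans _ _ ((2 * n + 1)%:R * (q r ^+ n.+1 / n.+1`!%:R))).
  have p0 := poisson_tail_ge0 n q0.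
  apply: ler_pM => //; [by rewrite mulr_ge0 ?wallis_ge0|by rewrite !mulr_ge0|].
  by rewrite -[leRHS]mulr1 ler_pM// mulr_ge0.
rewrite /exp_coeff /= factS natrM exprS.
have Q0 : 0 <= q r * (q r ^+ n / n`!%:R).
  by rewrite mulr_ge0// divr_ge0// exprn_ge0.
have -> : (2 * n + 1)%:R * (q r * q r ^+ n / (n.+1%:R * n`!%:R)) =
    ((2 * n + 1)%:R / n.+1%:R) * (q r * (q r ^+ n / n`!%:R)) :> R.
  have := natr_fact_neq0 R n; have : n.+1%:R != 0 :> R by rewrite pnatr_eq0.
  move: (n.+1%:R) (n`!%:R) => a b a0 b0; field.
  by rewrite a0 b0.
rewrite -[leRHS]mulrA ler_wpM2r// ler_pdivrMr// -natrM ler_nat.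
by rewrite mulnS addnC leq_add2r.
Qed.

(** Mean value theorem from 0, where the arctangent and all terms vanish and only
    [owen_integral h 0] is left over. *)
Lemma owen_remainder_le n r :
  `|atan r - (owen_integral h r - owen_integral h 0) - \sum_(k < n) owen_term k r| <=
  2 * q r * exp_coeff (q r) n * `|r|.
Proof.
have [c [cr _]] := mean_value_from0 r (is_derive_owen_remainder n).
have -> : \sum_(k < n) owen_term k 0 = 0.
  by rewrite big1// => k _; rewrite /owen_term addn1 exprS !mul0r !mulr0.
rewrite atan0 => E.
have -> : atan r - (owen_integral h r - owen_integral h 0) -
    \sum_(k < n) owen_term k r = owen_rest n c * r.
  rewrite -E; move: (\sum_(k < n) _) (atan r) (owen_integral h r) => s a k.
  by move: (owen_integral h 0) => k0; ring.
by rewrite normrM ler_wpM2r// owen_rest_le.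
Qed.

Lemma cvg_owen_series r :
  series (fun k => owen_term k r) @ \oo --> atan r - (owen_integral h r - owen_integral h 0).
Proof.
have H : 2 * q r * exp_coeff (q r) n * `|r| @[n --> \oo] --> (0 : R).
  rewrite -[X in _ --> X](mul0r `|r|) -(mulr0 (2 * q r)).
  apply: cvgM; last exact: cvg_cst.
  by apply: cvgM; [exact: cvg_cst|exact: cvg_exp_coeff].
apply/cvgrPdist_le => e e0.
move/cvgrPdist_le : H => /(_ e e0); apply: filterS => n.
rewrite sub0r normrN => /(le_trans (ler_norm _)) H.
by rewrite /series /= big_mkord (le_trans (owen_remainder_le n r)).
Qed.

End OwenSeries.

(** * Tails of the coefficient series and their geometric bound *)

Lemma cvg_series_tail (R : realType) (u : R ^nat) (N : nat) :
  cvgn (series u) ->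
  (\sum_(N <= k < n) u k) @[n --> \oo] -->
    limn (series u) - \sum_(0 <= k < N) u k.
Proof.
move=> cu; have H : series u n - \sum_(0 <= k < N) u k @[n --> \oo] -->
    limn (series u) - \sum_(0 <= k < N) u k.
  by apply: cvgB => //; exact: cvg_cst.
apply: cvg_trans H; apply: near_eq_cvg; near=> n.
rewrite /series /= (@big_cat_nat _ _ _ N 0 n)//=; last by near: n; exact: nbhs_infty_ge.
by rewrite addrAC subrr add0r.
Unshelve. all: by end_near. Qed.

(** Multiplying by [1 - y] telescopes the sum to [y^N - y^n]; for [n <= N] the sum is empty. *)
Lemma geometric_tail_sum_le (R : realFieldType) (y : R) (N n : nat) :
  0 <= y < 1 -> \sum_(N <= k < n) y ^+ k <= y ^+ N / (1 - y).
Proof.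
move=> /andP[y0 y1]; have y'0 : 0 < 1 - y by rewrite subr_gt0.
rewrite ler_pdivlMr//; have [nN|/ltnW Nn] := leqP n N.
  by rewrite big_geq// mul0r exprn_ge0.
suff -> : (\sum_(N <= k < n) y ^+ k) * (1 - y) = y ^+ N - y ^+ n.
  by rewrite gerBl exprn_ge0.
rewrite mulr_suml -[RHS]opprB -(telescope_sumr (fun k => y ^+ k) Nn) -sumrN.
by apply: eq_bigr => k _; rewrite opprB mulrBr mulr1 exprSr.
Qed.

Section CoefSeries.
Context {R : realType} (q z : R).
Hypotheses (q0 : 0 <= q) (z01 : 0 <= z < 1).

Let z0 : 0 <= z. Proof. by case/andP: z01. Qed.

Let e01 : 0 <= 1 - expR (- q) <= 1.
Proof. by rewrite subr_ge0 expR_le1 oppr_le0 q0 gerBl expR_ge0. Qed.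

Lemma coef_power_ge0 k : 0 <= coef q k * z ^+ k.
Proof.
by rewrite coef_wallis// !mulr_ge0 ?wallis_ge0 ?poisson_tail_ge0 ?exprn_ge0.
Qed.

(** Freezing the Wallis ratio at its largest value over [k >= N] makes the majorant geometric in
    [k], with ratio [(1 - e^{-q}) z]. *)
Lemma coef_power_le N k : (N <= k)%N ->
  coef q k * z ^+ k <=
  wallis R N * (1 - expR (- q)) * ((1 - expR (- q)) * z) ^+ k.
Proof.
move=> Nk; rewrite exprMn mulrA -(mulrA (wallis R N)) -exprS.
rewrite ler_wpM2r ?exprn_ge0// coef_wallis//.
apply: ler_pM; rewrite ?wallis_ge0 ?poisson_tail_ge0 ?wallis_nonincreasing//.
exact: poisson_tail_le_expr.
Qed.

Let y01 : 0 <= (1 - expR (- q)) * z < 1.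
Proof.
case/andP: e01 => e0 e1; case/andP: z01 => z0' z1; rewrite mulr_ge0//=.
by apply: le_lt_trans z1; rewrite ler_piMl.
Qed.

Lemma coef_power_partial_sum_le N n :
  \sum_(N <= k < n) coef q k * z ^+ k <=
  wallis R N * (1 - expR (- q)) ^+ N.+1 * z ^+ N / (1 - (1 - expR (- q)) * z).
Proof.
have e0 : 0 <= 1 - expR (- q) by case/andP: e01.
apply: (@le_trans _ _ (\sum_(N <= k < n)
    wallis R N * (1 - expR (- q)) * ((1 - expR (- q)) * z) ^+ k)).
  by apply: ler_sum_nat => k /andP[Nk _]; exact: coef_power_le.
move: (wallis R N) (wallis_ge0 R N) => w w0.
rewrite -mulr_sumr exprS -!mulrA (mulrA _ (z ^+ N)) -exprMn.
apply: ler_wpM2l => //.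
by apply: ler_wpM2l => //; exact: geometric_tail_sum_le.
Qed.

(** The terms are nonnegative and the geometric estimate with [N = 0] bounds all partial sums. *)
Lemma is_cvg_coef_series : cvgn (series (fun k => coef q k * z ^+ k)).
Proof.
apply: nondecreasing_is_cvgn.
  apply/nondecreasing_seqP => n; rewrite /series /= big_nat_recr//=.
  by rewrite lerDl coef_power_ge0.
exists (wallis R 0 * (1 - expR (- q)) ^+ 1 * z ^+ 0 / (1 - (1 - expR (- q)) * z)).
by move=> _ [n _ <-]; exact: coef_power_partial_sum_le.
Qed.

Lemma coef_tail_ge0 N : 0 <= \big[+%R/0]_(N <= k <oo) (coef q k * z ^+ k).
Proof.
apply: limr_ge; first by apply/cvg_ex; eexists; exact: cvg_series_tail is_cvg_coef_series.
by apply: nearW => n; apply: sumr_ge0 => k _; exact: coef_power_ge0.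
Qed.

Lemma coef_tail_le N :
  \big[+%R/0]_(N <= k <oo) (coef q k * z ^+ k) <=
  wallis R N * (1 - expR (- q)) ^+ N.+1 * z ^+ N / (1 - (1 - expR (- q)) * z).
Proof.
apply: limr_le; first by apply/cvg_ex; eexists; exact: cvg_series_tail is_cvg_coef_series.
by apply: nearW => n; exact: coef_power_partial_sum_le.
Qed.

Lemma coef_tailE N :
  \big[+%R/0]_(N <= k <oo) (coef q k * z ^+ k) =
  \big[+%R/0]_(0 <= k <oo) (coef q k * z ^+ k) -
  \sum_(0 <= k < N) (coef q k * z ^+ k).
Proof. by apply/cvg_lim => //; exact: cvg_series_tail is_cvg_coef_series. Qed.

End CoefSeries.

(** * Passage from [r] to [rho], and assembly of the expansion *)

Lemma atan_div_sqrt (R : realType) (rho : R) : -1 < rho < 1 ->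
  atan (rho / Num.sqrt (1 - rho ^+ 2)) = asin rho.
Proof.
move=> /andP[rho1 rho2]; have ri : -1 <= rho <= 1 by rewrite !ltW.
(* With [x = asin rho] the quotient is [sin x / cos x], and [x] lies in the range where [atan]
   inverts [tan]. *)
rewrite -(cos_asin ri) -{1}(@asinK _ rho) ?in_itv//= -/(tan _) tanK// in_itv/=.
by rewrite asin_gtNpi2 ?rho1 ?ltW// asin_ltpi2// rho2 ltW.
Qed.

(** Links the terms that were differentiated to the coefficients of the theorem: the common factor
    takes one [r] from the odd power and one of the [k+1] inverse powers. *)
Lemma owen_term_coef (R : realType) (h r : R) k :
  owen_term h k r = r / (1 + r ^+ 2) *
    (coef (1 / 2 * (1 + r ^+ 2) * h ^+ 2) k * (r ^+ 2 / (1 + r ^+ 2)) ^+ k).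
Proof.
rewrite /owen_term coef_wallis; last first.
  by rewrite mulr_ge0 ?sqr_ge0// mulr_ge0// addr_ge0 ?sqr_ge0.
rewrite addn1 (exprS r (2 * k)) (exprM r 2) (exprS _ k) (exprMn k (r ^+ 2)).
by move: (wallis R k) (poisson_tail k _) ((r ^+ 2) ^+ k) (_^-1 ^+ k) => w p a b; ring.
Qed.

Lemma div_sqrt_identities (R : realType) (rho : R) : -1 < rho < 1 ->
  let r := rho / Num.sqrt (1 - rho ^+ 2) in
  [/\ 1 + r ^+ 2 = (1 - rho ^+ 2)^-1, r ^+ 2 / (1 + r ^+ 2) = rho ^+ 2
    & r / (1 + r ^+ 2) = Num.sqrt (1 - rho ^+ 2) * rho].
Proof.
move=> rho1 r.
have o0 : 0 < 1 - rho ^+ 2.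
  by rewrite subr_gt0 -real_normK ?num_real// expr_lt1// ltr_norml.
have := sqr_sqrtr (ltW o0); have := o0; rewrite -sqrtr_gt0 => /lt0r_neq0.
rewrite /r; move: (Num.sqrt _) => s s0 s2.
have -> : 1 + (rho / s) ^+ 2 = (1 - rho ^+ 2)^-1.
  rewrite -s2 expr_div_n; have -> : rho ^+ 2 = 1 - s ^+ 2 by rewrite s2; ring.
  by field.
by split=> //; rewrite -s2; field.
Qed.

Lemma Phi2_coef_series (R : realType) (h rho : R) : -1 < rho < 1 ->
  let r := rho / Num.sqrt (1 - rho ^+ 2) in
  Phi2 rho h 0 = 1 / 2 * Phi h + atan r / (2 * pi)
    - r / (2 * pi * (1 + r ^+ 2)) * \big[+%R/0]_(0 <= k <oo)
      (coef (1 / 2 * (1 + r ^+ 2) * h ^+ 2) k * (r ^+ 2 / (1 + r ^+ 2)) ^+ k).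
Proof.
move=> rho1 r; rewrite Phi2E// PhiE -/r; set S := limn _.
have r0 : 0 < 1 + r ^+ 2 by rewrite ltr_pwDl ?sqr_ge0.
have cS : cvgn (series (fun k => coef (1 / 2 * (1 + r ^+ 2) * h ^+ 2) k *
    (r ^+ 2 / (1 + r ^+ 2)) ^+ k)).
  apply: is_cvg_coef_series.
    by rewrite mulr_ge0 ?sqr_ge0// mulr_ge0// ltW.
  by rewrite divr_ge0 ?sqr_ge0 ?ltW//= ltr_pdivrMr// mul1r ltrDr.
(* Uniqueness of limits: the same partial sums converge to the left side by [cvg_owen_series] and,
   through [owen_term_coef], to the right side. *)
have E : atan r - (owen_integral h r - owen_integral h 0) = r / (1 + r ^+ 2) * S.
  rewrite -(cvg_lim (@Rhausdorff R) (@cvg_owen_series R h r)).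
  apply: cvg_lim => //.
  have : r / (1 + r ^+ 2) * series (fun k =>
      coef (1 / 2 * (1 + r ^+ 2) * h ^+ 2) k * (r ^+ 2 / (1 + r ^+ 2)) ^+ k) n
      @[n --> \oo] --> r / (1 + r ^+ 2) * S.
    by apply: cvgM; [exact: cvg_cst|exact: cS].
  apply: cvg_trans; apply: near_eq_cvg; near=> n.
  rewrite /series /= mulr_sumr; apply: eq_bigr => k _.
  by rewrite owen_term_coef.
have -> : r / (2 * pi * (1 + r ^+ 2)) * S = r / (1 + r ^+ 2) * S / (2 * pi).
  have : 2 * pi != 0 :> R by rewrite mulf_neq0 ?gt_eqF ?pi_gt0.
  by move: (2 * pi) => p p0; field; rewrite p0 gt_eqF.
rewrite -E.
by move: (atan r) (owen_integral h r) (owen_integral h 0) (2 * pi) => a k k0 p; ring.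
Unshelve. all: by end_near. Qed.

(** Lets the sign in front of [R_n] absorb its [|r|], so that both pieces of the split series carry
    the factor [r]. *)
Lemma sgnM_norm (R : realType) (x : R) : sgn x * `|x| = x.
Proof.
rewrite /sgn; have [x0|x0] := leP 0 x; first by rewrite mul1r ger0_norm.
by rewrite ltr0_norm// mulrNN mul1r.
Qed.

Theorem theorem3 (R : realType) :
  (forall r h : R,
     let q := 1 / 2 * (1 + r ^+ 2) * h ^+ 2 in
     cvgn (series (fun k : nat => coef q k * (r ^+ 2 / (1 + r ^+ 2)) ^+ k)))
  /\
  (forall h rho : R, -1 < rho < 1 ->
     let r := rho / Num.sqrt (1 - rho ^+ 2) in
     let q := 1 / 2 * (1 + r ^+ 2) * h ^+ 2 in
     let c := coef q in
     let z := r ^+ 2 / (1 + r ^+ 2) in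
     [/\ q = h ^+ 2 / (2 * (1 - rho ^+ 2)),
         Phi2 rho h 0 = 1 / 2 * Phi h + atan r / (2 * pi)
           - r / (2 * pi * (1 + r ^+ 2)) * \big[+%R/0]_(0 <= k <oo) (c k * z ^+ k),
         cvgn (series (fun k : nat => c k * rho ^+ (2 * k + 1))),
         Phi2 rho h 0 = 1 / 2 * Phi h + asin rho / (2 * pi)
           - Num.sqrt (1 - rho ^+ 2) / (2 * pi)
             * \big[+%R/0]_(0 <= k <oo) (c k * rho ^+ (2 * k + 1))
       & forall n : int, -1 <= n ->
         let S_n := \sum_(0 <= k < absz (n + 1)) (c k * z ^+ k) in
         let R_n := `|r| / (2 * pi * (1 + r ^+ 2))
                    * \big[+%R/0]_(absz (n + 1) <= k <oo) (c k * z ^+ k) in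
         let B_n := (double_fact (absz (2 * n + 2)))%:R
                    / (double_fact (absz (2 * n + 3)))%:R
                    * (`|r| / (2 * pi))
                    * (1 - expR (- q)) ^ (n + 2) * z ^ (n + 1) in
         [/\ Phi2 rho h 0 = 1 / 2 * Phi h + atan r / (2 * pi)
               - r * S_n / (2 * pi * (1 + r ^+ 2)) - sgn r * R_n,
             0 <= R_n,
             R_n <= B_n / (1 + expR (- q) * r ^+ 2)
           & B_n / (1 + expR (- q) * r ^+ 2) <= B_n]]).
Proof.
have one0 (r : R) : 0 < 1 + r ^+ 2 by rewrite ltr_pwDl ?sqr_ge0.
have q_ge0 (r h : R) : 0 <= 1 / 2 * (1 + r ^+ 2) * h ^+ 2.
  by rewrite mulr_ge0 ?sqr_ge0// mulr_ge0// ltW.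
have z01 (r : R) : 0 <= r ^+ 2 / (1 + r ^+ 2) < 1.
  by rewrite divr_ge0 ?sqr_ge0 ?ltW//= ltr_pdivrMr// mul1r ltrDr.
split; first by move=> r h q; apply: is_cvg_coef_series => //; exact: q_ge0.
move=> h rho rho1 r q c z.
have [rE zE rsE] := div_sqrt_identities rho1; rewrite -/r in rE zE rsE.
rewrite -/z in zE.
have qq0 : 0 <= q := q_ge0 r h; have zz := z01 r; rewrite -/z in zz.
have cS := is_cvg_coef_series qq0 zz.
have P := Phi2_coef_series h rho1; rewrite /= -/r -/q -/z -/c in P.
(* As [z = rho^2], the odd power of [rho] is [rho * z^k]. *)
have rhoE : (fun k => c k * rho ^+ (2 * k + 1)) = (fun k => rho * (c k * z ^+ k)).
  by apply/funext => k; rewrite zE addn1 exprS exprM mulrCA.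
have cS2 : series (fun k => c k * rho ^+ (2 * k + 1)) @ \oo -->
    rho * \big[+%R/0]_(0 <= k <oo) (c k * z ^+ k).
  rewrite rhoE; have : rho * series (fun k => c k * z ^+ k) n @[n --> \oo] -->
      rho * \big[+%R/0]_(0 <= k <oo) (c k * z ^+ k).
    by apply: cvgM; [exact: cvg_cst|exact: cS].
  by apply: cvg_trans; apply: near_eq_cvg; near=> n; rewrite /series /= mulr_sumr.
have pi20 : 2 * pi != 0 :> R by rewrite mulf_neq0 ?gt_eqF ?pi_gt0.
have rw : r / (2 * pi * (1 + r ^+ 2)) = r / (1 + r ^+ 2) / (2 * pi).
  by rewrite invfM mulrA mulrAC.
have one_neq0 : 1 + r ^+ 2 != 0 by rewrite gt_eqF.
split.
- by rewrite /q rE invfM; ring.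
- exact: P.
- by apply/cvg_ex; eexists; exact: cS2.
- rewrite (cvg_lim (@Rhausdorff R) cS2) P -(atan_div_sqrt rho1) -/r.
  by congr (_ - _); rewrite rw rsE !mulrA; congr (_ * _); rewrite mulrAC.
move=> n n1 S_n R_n B_n.
(* [N = n + 1] counts the retained terms and is the index of the first omitted one; in terms of it
   the integer indices and exponents become natural numbers. *)
have [N nE] : exists N : nat, n = N%:Z - 1.
  by exists (absz (n + 1)); rewrite gez0_abs ?addrK// -lerBlDr sub0r.
have n1E : n + 1 = N by rewrite nE subrK.
have n2E : n + 2 = N.+1 by rewrite nE; lia.
have m2E : 2 * n + 2 = (2 * N)%N by rewrite nE; lia.
have m3E : 2 * n + 3 = (2 * N + 1)%N by rewrite nE; lia.
pose e := expR (- q); pose T := \big[+%R/0]_(N <= k <oo) (c k * z ^+ k).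
have S_nE : S_n = \sum_(0 <= k < N) (c k * z ^+ k) by rewrite /S_n n1E.
have R_nE : R_n = `|r| / (2 * pi) / (1 + r ^+ 2) * T.
  by rewrite /R_n n1E invfM mulrA.
have B_nE : B_n = wallis R N * (`|r| / (2 * pi)) * (1 - e) ^+ N.+1 * z ^+ N.
  by rewrite /B_n n1E n2E m2E m3E.
have TE : T = \big[+%R/0]_(0 <= k <oo) (c k * z ^+ k) - S_n.
  by rewrite S_nE; exact: coef_tailE.
have T0 : 0 <= T by exact: coef_tail_ge0.
have Tle : T <= wallis R N * (1 - e) ^+ N.+1 * z ^+ N / (1 - (1 - e) * z).
  exact: coef_tail_le.
have e0 : 0 <= e by exact: expR_ge0.
have e1 : 0 <= 1 - e by rewrite subr_ge0 expR_le1 oppr_le0.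
have er0 : 0 < 1 + e * r ^+ 2 by rewrite ltr_pwDl// mulr_ge0 ?sqr_ge0.
have z0 : 0 <= z by case/andP: zz.
have pi2_ge0 : 0 <= (2 * pi)^-1 :> R by rewrite invr_ge0 mulr_ge0 ?pi_ge0.
have w0 : 0 <= (1 + r ^+ 2)^-1 by rewrite invr_ge0 ltW.
have B0 : 0 <= B_n by rewrite B_nE !mulr_ge0 ?wallis_ge0 ?exprn_ge0.
split.
- rewrite P R_nE TE !(mulrA (sgn r)) sgnM_norm.
  move: (limn _) (1 / 2 * Phi h) (atan r) (2 * pi) pi20 => S A B p p0.
  by field; rewrite one_neq0 p0.
- by rewrite R_nE !mulr_ge0.
- have -> : B_n / (1 + e * r ^+ 2) = `|r| / (2 * pi) / (1 + r ^+ 2) *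
      (wallis R N * (1 - e) ^+ N.+1 * z ^+ N / (1 - (1 - e) * z)).
    (* The denominator of the geometric sum: its [1 + r^2] cancels the one in [R_n], leaving
       [1 + e r^2]. *)
    have -> : 1 - (1 - e) * z = (1 + e * r ^+ 2) / (1 + r ^+ 2).
      by rewrite /z; field.
    rewrite B_nE.
    move: (wallis R N) ((1 - e) ^+ N.+1) (z ^+ N) (`|r| / (2 * pi)) => w a b d.
    by field; rewrite one_neq0 gt_eqF.
  by rewrite R_nE ler_wpM2l// !mulr_ge0.
- by rewrite ler_pdivrMr// ler_peMr// lerDl mulr_ge0 ?sqr_ge0.
Unshelve. all: by end_near. Qed.
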